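(* Let $k,\ell$ be nonnegative integers with $k\geq 3\ell+3$. Then every tight $(k,\ell)$-stable graph has at most $(k-3\ell-3)+2^{3(\ell+4)^2}$ vertices. In particular, for every integer $k\geq 6$, every tight $(k,1)$-stable graph has at most $k-6+2^{75}$ vertices.
   Context: All graphs are finite, simple and undirected. $\alpha(G)$ denotes the independence number of $G$, and $G-S$ denotes the subgraph of $G$ induced on $V(G)\setminus S$. For integers $k>\ell\geq 0$, a graph $G$ is $(k,\ell)$-stable if for every $S\subseteq V(G)$ with $|S|=k$ we have $\alpha(G-S)\geq \alpha(G)-\ell$. A $(k,\ell)$-stable graph $G$ on $n$ vertices is tight if $\alpha(G)=\left\lfloor \frac{n-k+1}{2}\right\rfloor+\ell$. *)

(* Defs.v *)
From mathcomp Require Import all_boot all_order all_algebra.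
Set Implicit Arguments.
Unset Strict Implicit.
Unset Printing Implicit Defensive.

Record sgraph := SGraph {
  vertex :> finType;
  adj : rel vertex;
  adj_sym : symmetric adj;
  adj_irrefl : irreflexive adj
}.

Section Induced.

Variables (G : sgraph) (A : {set G}).

Definition induced_adj : rel {x : G | x \in A} :=
  fun x y => adj (val x) (val y).

Lemma induced_sym : symmetric induced_adj.
Proof. by move=> x y; apply: adj_sym. Qed.

Lemma induced_irrefl : irreflexive induced_adj.
Proof. by move=> x; apply: adj_irrefl. Qed.

Definition induced : sgraph := SGraph induced_sym induced_irrefl.

End Induced.

Definition del_vertices (G : sgraph) (S : {set G}) : sgraph := induced (~: S).

Definition independent (G : sgraph) (A : {set G}) : bool :=
  [forall x in A, forall y in A, ~~ adj x y].

Definition alpha (G : sgraph) : nat := \max_(A : {set G} | independent A) #|A|.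

(* Only meaningful for l < k. Since alpha is nonnegative, the truncated
   subtraction gives the same condition as subtraction in the integers. *)
Definition stable (k l : nat) (G : sgraph) : Prop :=
  forall S : {set G}, #|S| = k -> alpha G - l <= alpha (del_vertices S).

(* Stated in int because #|G| - k + 1 may be negative; division by 2 in int
   rounds down, so it is the floor. *)
Definition tight (k l : nat) (G : sgraph) : Prop :=
  stable k l G /\
  ((alpha G)%:Z = ((#|G|%:Z - k%:Z + 1) %/ 2)%Z + l%:Z)%R.

(* Main.v *)
Require Import Defs.
From mathcomp Require Import all_boot all_order all_algebra.
From mathcomp Require Import zify.
Set Implicit Arguments.
Unset Strict Implicit.
Unset Printing Implicit Defensive.

(** Write a(G) for the independence number and d = n - 2 a(G) for the deficiency.

    Everything rests on one finiteness statement: if deleting at most three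
    vertices never lowers a(G), then a(G) <= (2^d (d+1))^3 ([robust_bound]).
    Granting it, let G be tight and large.  Delete k - 3l - 3 vertices outside
    a maximum independent set, which keeps a(G) and leaves deficiency at most
    l + 3.  As long as the remaining graph is large some three vertices lower
    a by at least one, and stability keeps a within l of its initial value, so
    the deficiency stays below 3l + 4 and the deletion can be repeated l + 1
    times ([descent]).  That removes k vertices and lowers a by l + 1, against
    stability.

    For the finiteness statement, edges whose deletion keeps a(G) may be
    deleted, so every edge may be taken critical; a vertex of degree at most
    two, deleted with its neighbours, would lower a(G), so all degrees are at
    least three.  Fix a maximum independent set I with complement C, and for X
    inside C let nb X be its neighbourhood in I.  Independent sets X satisfy
    |X| <= |nb X| by maximality of I; arbitrary ones satisfy
    |X| <= |nb X| + d ([deficiency_bound]).  Two ideas bound |I|.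

    - Types.  There are at most 2^d subsets of C satisfying Hall's condition
      that together capture all independent subsets of C ([hall_cover]): a
      minimal set of largest deficiency contains an edge uv, an independent
      set misses u or v, and forbidding either one lowers the deficiency.

    - Orders.  Inside a Hall set X the saturated sets (|Y| = |nb Y|) form a
      distributive lattice.  A critical edge ic with i in I yields saturated
      sets Y and Y - c with nb Y = nb (Y - c) + i ([critical_forced]), so a
      maximal chain of saturated sets has exactly one step at which i enters
      the neighbourhood, and c enters the chain at the same step
      ([before_succ_chain]).  The chain thus orders the vertices i of type X.

    Each i in I has three critical edges, hence lies in three such orders.
    For two vertices whose three types agree, two of the three orders compare
    them the same way.  Joining the corresponding chain members of these two
    orders gives a set U with |U| - |nb U| strictly increasing along both
    orders ([defect_lt]): two vertices of C are added for the single new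
    neighbour i, and by submodularity nothing is lost in between.  Since this
    quantity is at most d, three types and three integers in [0, d] determine
    i ([card_le_types]). *)

(** * Independent sets *)

Section Alpha.

Variable G : sgraph.
Implicit Types A B S : {set G}.

Lemma independentP A :
  reflect {in A &, forall x y, ~~ adj x y} (independent A).
Proof.
apply: (iffP forall_inP) => [h x y xA yA|h x xA]; first exact: (forall_inP (h x xA)).
by apply/forall_inP => y yA; apply: h.
Qed.

Lemma independentS A B : A \subset B -> independent B -> independent A.
Proof.
move=> /subsetP sAB /independentP iB; apply/independentP => x y xA yA.
by apply: iB; apply: sAB.
Qed.

Lemma leq_alpha A : independent A -> #|A| <= alpha G.
Proof. by move=> iA; apply: (bigmax_sup A). Qed.

Lemma alpha_witness : exists2 A : {set G}, independent A & #|A| = alpha G.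
Proof.
have i0 : @independent G set0 by apply/independentP => x y; rewrite inE.
rewrite /alpha (bigop.bigmax_eq_arg set0) //; case: arg_maxnP => // A iA _.
by exists A.
Qed.

Lemma card_extend S m : #|S| <= m <= #|G| -> exists2 S' : {set G}, S \subset S' & #|S'| = m.
Proof.
elim: m => [|m IH] /andP[Sm mG]; first by exists S => //; apply/eqP; rewrite -leqn0.
case: (ltngtP #|S| m.+1) Sm => // [Sm _|<- _]; last by exists S.
have [|S' sS' cS'] := IH; first by rewrite -ltnS Sm ltnW.
have /set0Pn[x] : ~: S' != set0 by rewrite -card_gt0 cardsCs setCK cS' subn_gt0.
rewrite inE => xS'; exists (x |: S'); last by rewrite cardsU1 xS' cS'.
exact: subset_trans sS' (subsetUr _ _).
Qed.

End Alpha.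

(** * Hall sets and saturated sets *)

Section BipartiteDeficiency.

Variables (G : sgraph) (I : {set G}).
Implicit Types (i j c : G) (X Y Z W : {set G}).

Definition nb X := [set i in I | [exists c in X, adj i c]].

Lemma nbP i X : reflect (i \in I /\ exists2 c, c \in X & adj i c) (i \in nb X).
Proof.
rewrite inE; apply: (iffP andP) => [[iI /exists_inP]|[iI h]] //.
by split=> //; apply/exists_inP.
Qed.

Lemma nbS X Y : X \subset Y -> nb X \subset nb Y.
Proof.
move=> /subsetP sXY; apply/subsetP => i /nbP[iI [c cX ic]]; apply/nbP; split=> //.
by exists c => //; apply: sXY.
Qed.

Lemma nbU X Y : nb (X :|: Y) = nb X :|: nb Y.
Proof.
apply/eqP; rewrite eqEsubset subUset !nbS ?subsetUl ?subsetUr //= andbT.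
apply/subsetP => i /nbP[iI [c]]; rewrite !inE iI /= => /orP[cX|cY] ic; apply/orP.
  by left; apply/exists_inP; exists c.
by right; apply/exists_inP; exists c.
Qed.

Lemma nbIsub X Y : nb (X :&: Y) \subset nb X :&: nb Y.
Proof. by rewrite subsetI !nbS ?subsetIl ?subsetIr. Qed.

Lemma nb_submodular X Y :
  #|nb (X :|: Y)| + #|nb (X :&: Y)| <= #|nb X| + #|nb Y|.
Proof.
have := subset_leq_card (nbIsub X Y); rewrite nbU.
have := cardsUI (nb X) (nb Y); lia.
Qed.

Definition hall X := forall Y, Y \subset X -> #|Y| <= #|nb Y|.

Definition saturated Y := #|nb Y| == #|Y|.

(** [#|nb Y|] is submodular and, inside [X], bounded below by the modular
    [#|Y|]; so the sets where the bound is attained form a lattice, on which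
    [nb] also commutes with intersections. *)
Lemma saturatedUI X Y Z : hall X -> Y \subset X -> Z \subset X ->
  saturated Y -> saturated Z ->
  [/\ saturated (Y :|: Z), saturated (Y :&: Z) & nb (Y :&: Z) = nb Y :&: nb Z].
Proof.
move=> hX YX ZX /eqP sY /eqP sZ.
have hU : #|Y :|: Z| <= #|nb (Y :|: Z)| by apply: hX; rewrite subUset YX.
have hI : #|Y :&: Z| <= #|nb (Y :&: Z)|.
  by apply: hX; apply: subset_trans YX; apply: subsetIl.
have := cardsUI Y Z; have := cardsUI (nb Y) (nb Z); rewrite -nbU => e1 e2.
have le := subset_leq_card (nbIsub Y Z).
split; [apply/eqP; lia|apply/eqP; lia|].
by apply/eqP; rewrite eqEcard nbIsub /=; lia.
Qed.

(** Among subsets of a saturated [Z'] satisfying Hall's condition, [Z'] itself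
    minimises [#|nb Y| - #|Y|]; hence enlarging [Z] to [Z'] can only increase the
    deficiency of its union with a fixed set. *)
Lemma deficiency_mono X Y Z Z' : hall X -> Z' \subset X -> saturated Z' ->
  Z \subset Z' -> #|Z :|: Y| + #|nb (Z' :|: Y)| <= #|Z' :|: Y| + #|nb (Z :|: Y)|.
Proof.
move=> hX ZX /eqP sZ ZZ'.
have := nb_submodular Z' (Z :|: Y); have := cardsUI Z' (Z :|: Y).
rewrite setUA (setUidPl ZZ').
have : #|Z' :&: (Z :|: Y)| <= #|nb (Z' :&: (Z :|: Y))|.
  by apply: hX; apply: subset_trans ZX; apply: subsetIl.
lia.
Qed.

(** Sets of maximal deficiency are closed under intersection, so a smallest one
    lies inside all of them and removing any of its points lowers the maximal
    deficiency.  It is not independent, and of the two ends of an edge in it an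
    independent set misses at least one: two branches, each of smaller
    deficiency. *)
Lemma hall_cover v W :
  (forall Y, Y \subset W -> independent Y -> #|Y| <= #|nb Y|) ->
  (forall X, X \subset W -> #|X| <= #|nb X| + v) ->
  exists F : {set {set G}}, [/\ #|F| <= 2 ^ v,
    forall X, X \in F -> hall X /\ X \subset W &
    forall Y, Y \subset W -> independent Y -> exists2 X : {set G}, X \in F & Y \subset X].
Proof.
elim: v W => [|v IH] W indW defW.
  exists [set W]; split=> [|X|Y YW _]; first by rewrite cards1.
    by rewrite inE => /eqP->; split=> // Y YW; have := defW Y YW; rewrite addn0.
  by exists W; rewrite ?inE.
pose bad X := (X \subset W) && (#|X| == #|nb X| + v.+1).
have [X0 bX0|nobad] := pickP bad; last first.
  have [|F [cF hF covF]] := IH W indW.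
    move=> X XW; have := defW X XW; have := nobad X; rewrite /bad XW /=; lia.
  by exists F; split=> //; apply: leq_trans cF _; rewrite leq_exp2l.
case: (arg_minnP (fun X : {set G} => #|X|) bX0) => X /andP[XW /eqP dX] minX.
have : ~~ independent X by apply/negP => /(indW _ XW); lia.
move=> /forall_inPn[u uX /forall_inPn[w wX]]; rewrite negbK => uw.
(* a maximally deficient [Y] avoiding [x] would make [X :&: Y] smaller than [X] *)
have step x : x \in X -> forall Y, Y \subset W :\ x -> #|Y| <= #|nb Y| + v.
  move=> xX Y; rewrite subsetD1 => /andP[YW xY].
  rewrite leqNgt; apply/negP => dY.
  have bI : bad (X :&: Y).
    have IW : X :&: Y \subset W by apply: subset_trans XW; apply: subsetIl.
    rewrite /bad IW /=; have := defW _ IW.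
    have UW : X :|: Y \subset W by rewrite subUset XW.
    have := defW _ UW; have := nb_submodular X Y; have := cardsUI X Y; lia.
  have := minX _ bI; rewrite leqNgt => /negP; apply.
  apply: proper_card; apply/properP; split; first exact: subsetIl.
  by exists x; rewrite // inE (negPf xY) andbF.
have sub x : W :\ x \subset W by apply: subsetDl.
have ind x Y : Y \subset W :\ x -> independent Y -> #|Y| <= #|nb Y|.
  by move=> YW; apply: indW; apply: subset_trans YW _.
have [F1 [c1 h1 cov1]] := IH _ (@ind u) (step u uX).
have [F2 [c2 h2 cov2]] := IH _ (@ind w) (step w wX).
exists (F1 :|: F2); split=> [|Y|Y YW iY].
- by rewrite cardsU expnS; lia.
- by rewrite inE => /orP[/h1[]|/h2[]] hY YW; split=> //; apply: subset_trans YW _.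
have [uY|uY] := boolP (u \in Y); last first.
  by have [|Z ZF YZ] := cov1 Y _ iY; [rewrite subsetD1 YW|exists Z; rewrite // inE ZF].
have wY : w \notin Y by apply/negP => wY; move/independentP/(_ u w uY wY): iY; rewrite uw.
by have [|Z ZF YZ] := cov2 Y _ iY; [rewrite subsetD1 YW|exists Z; rewrite // inE ZF orbT].
Qed.

(** In matching terms, [i] is matched to [c] in every perfect matching between
    [Y] and its neighbourhood. *)
Definition forced X i c Y :=
  [&& i \in I, c \in Y, adj i c, Y \subset X, saturated Y, saturated (Y :\ c)
    & i \notin nb (Y :\ c)].

(** * Maximal chains of saturated sets *)

Definition saturated_chain X (F : {set {set G}}) :=
  [forall Y in F, (Y \subset X) && saturated Y] &&
  [forall Y in F, forall Z in F, (Y \subset Z) || (Z \subset Y)].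

Definition max_chain X : {set {set G}} :=
  odflt set0 [pick F | maxset (saturated_chain X) F].

Lemma max_chainP X : maxset (saturated_chain X) (max_chain X).
Proof.
rewrite /max_chain; case: pickP => //= no.
have [|F mF] := @ex_maxset _ (saturated_chain X); last by rewrite no in mF.
exists set0; apply/andP; split; apply/forall_inP => Y; by rewrite inE.
Qed.

(** The last member of the chain at which [i] is not yet a neighbour. *)
Definition before X i := \bigcup_(Y in max_chain X | i \notin nb Y) Y.

Section InsideHall.

Variable X : {set G}.
Hypothesis hallX : hall X.
Local Notation F := (max_chain X).

Lemma chain_sub Y : Y \in F -> Y \subset X.
Proof.
by have /maxsetp/andP[/forall_inP h _] := max_chainP X; move=> /h/andP[].
Qed.

Lemma chain_sat Y : Y \in F -> saturated Y.
Proof.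
by have /maxsetp/andP[/forall_inP h _] := max_chainP X; move=> /h/andP[].
Qed.

Lemma chain_total Y Z : Y \in F -> Z \in F -> (Y \subset Z) || (Z \subset Y).
Proof.
have /maxsetp/andP[_ /forall_inP h] := max_chainP X.
by move=> /h/forall_inP; apply.
Qed.

(** Maximality of the chain, in the form in which it is used. *)
Lemma mem_chain Y : Y \subset X -> saturated Y ->
  (forall Z, Z \in F -> (Y \subset Z) || (Z \subset Y)) -> Y \in F.
Proof.
move=> YX sY tY; have /maxsetP[_ maxF] := max_chainP X.
rewrite -(maxF (Y |: F)) ?setU11 ?subsetUr //.
apply/andP; split; apply/forall_inP => Z.
  by rewrite !inE => /orP[/eqP->|ZF]; rewrite ?YX // chain_sub ?chain_sat.
rewrite !inE => ZF; apply/forall_inP => Z'; rewrite !inE => Z'F.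
case/orP: ZF => [/eqP->|ZF]; case/orP: Z'F => [/eqP->|Z'F].
- by rewrite subxx.
- exact: tY.
- by rewrite orbC tY.
- exact: chain_total.
Qed.

Lemma before_ge i Y : Y \in F -> i \notin nb Y -> Y \subset before X i.
Proof. by move=> YF iY; apply: (bigcup_max Y); rewrite ?YF. Qed.

Lemma before_le i Y : Y \in F -> i \in nb Y -> before X i \subset Y.
Proof.
move=> YF iY; apply/bigcupsP => Z /andP[ZF iZ].
case/orP: (chain_total YF ZF) => // /nbS/subsetP/(_ _ iY).
by rewrite (negPf iZ).
Qed.

Lemma before_nb i : i \notin nb (before X i).
Proof.
apply/negP => /nbP[iI [c /bigcupP[Y /andP[YF iY] cY] ic]].
by case/negP: iY; apply/nbP; split=> //; exists c.
Qed.

Lemma before_chain i : before X i \in F.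
Proof.
apply: mem_chain => [||Z ZF]; last first.
- have [iZ|iZ] := boolP (i \in nb Z); first by rewrite before_le.
  by rewrite (before_ge ZF iZ) orbT.
- suff /andP[] : (before X i \subset X) && saturated (before X i) by [].
  rewrite /before; elim/big_rec: _ => [|Y Z /andP[YF _] /andP[ZX sZ]].
    rewrite sub0set /saturated cards0 -leqn0 leqNgt card_gt0.
    by apply/negP => /set0Pn[j /nbP[_ [c]]]; rewrite inE.
  have YX := chain_sub YF; rewrite subUset YX ZX /=.
  by have [] := saturatedUI hallX YX ZX (chain_sat YF) sZ.
- by apply/bigcupsP => Y /andP[YF _]; apply: chain_sub.
Qed.

Section Forced.

Variables (i c : G) (Y : {set G}).
Hypothesis fY : forced X i c Y.

Lemma forced_unique Z : i \in nb Z -> Z \subset Y -> c \in Z.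
Proof.
case/and5P: fY => _ _ _ _ /and3P[_ _ iYc] iZ ZY.
case: (boolP (c \in Z)) => // cZ; case/negP: iYc.
by move: i iZ; apply/subsetP; apply: nbS; rewrite subsetD1 ZY.
Qed.

Lemma forced_notin : c \notin before X i.
Proof.
apply/negP => cL; case/negP: (before_nb i); apply/nbP.
by case/and5P: fY => iI _ ic _ _; split=> //; exists c.
Qed.

Lemma before_succ_le Z : Z \in F -> i \in nb Z -> c |: before X i \subset Z.
Proof.
move=> ZF iZ; rewrite subUset before_le // sub1set andbT.
case/and5P: fY => iI cY ic YX /and3P[sY _ _].
have [_ _ e] := saturatedUI hallX YX (chain_sub ZF) sY (chain_sat ZF).
suff : c \in Y :&: Z by rewrite inE => /andP[].
apply: forced_unique (subsetIl _ _); rewrite e inE iZ andbT.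
by apply/nbP; split=> //; exists c.
Qed.

(** The successor of [before X i] in the chain adds exactly [c].  Cut [Y] and
    [Y :\ c] down to [M], the part below every later member, and join both with
    [before X i]: the second join still avoids [i] as a neighbour, so by
    maximality it adds nothing, and the first adds only [c]. *)
Lemma before_succ_chain : c |: before X i \in F.
Proof.
case/and5P: (fY) => iI cY ic YX /and3P[sY sYc iYc].
set L := before X i; have LF : L \in F := before_chain i.
have cmp Z : Z \in F -> (c |: L \subset Z) || (Z \subset c |: L).
  move=> ZF; have [iZ|iZ] := boolP (i \in nb Z); first by rewrite before_succ_le.
  by rewrite (subset_trans (before_ge ZF iZ) (subsetUr _ _)) orbT.
pose M := X :&: \bigcap_(Z in F | i \in nb Z) Z.
have cM : c \in M.
  rewrite inE (subsetP YX) //=; apply/bigcapP => Z /andP[ZF iZ].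
  by apply: (subsetP (before_succ_le ZF iZ)); rewrite setU11.
have [sMY sMYc] : saturated (Y :&: M) /\ saturated ((Y :\ c) :&: M).
  have ScX : Y :\ c \subset X by apply: subset_trans YX; apply: subsetDl.
  rewrite /M !setIA (setIidPl YX) (setIidPl ScX).
  elim/big_rec: _ => [|Z B /andP[ZF _] [IH1 IH2]]; first by rewrite !setIT.
  have ZX := chain_sub ZF; rewrite ![Z :&: _]setIC !setIA.
  have YBX : Y :&: B \subset X by apply: subset_trans YX; apply: subsetIl.
  have YcBX : (Y :\ c) :&: B \subset X by apply: subset_trans ScX; apply: subsetIl.
  have [_ ? _] := saturatedUI hallX YBX ZX IH1 (chain_sat ZF).
  by have [_ ? _] := saturatedUI hallX YcBX ZX IH2 (chain_sat ZF).
have LX := chain_sub LF; have sL := chain_sat LF.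
have LM : L \subset M.
  by rewrite subsetI LX; apply/bigcapsP => Z /andP[ZF iZ]; apply: before_le.
have IX (A : {set G}) : A \subset X -> A :&: M \subset X by apply: subset_trans; apply: subsetIl.
have ScX : Y :\ c \subset X by apply: subset_trans YX; apply: subsetDl.
have [sU1 _ _] := saturatedUI hallX LX (IX _ YX) sL sMY.
have [sU2 _ _] := saturatedUI hallX LX (IX _ ScX) sL sMYc.
set L2 := L :|: ((Y :\ c) :&: M) in sU2.
have iL2 : i \notin nb L2.
  rewrite nbU inE negb_or before_nb /=; apply: contra iYc.
  by move: i; apply/subsetP; apply: nbS; apply: subsetIl.
have L2F : L2 \in F.
  apply: mem_chain => //; first by rewrite subUset LX IX.
  move=> Z ZF; have [iZ|iZ] := boolP (i \in nb Z); last first.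
    by rewrite (subset_trans (before_ge ZF iZ) (subsetUl _ _)) orbT.
  suff MZ : M \subset Z by rewrite subUset (subset_trans LM MZ) subIset ?MZ ?orbT.
  by rewrite /M subIset //; apply/orP; right; apply: bigcap_inf; rewrite ZF.
have L2L := before_ge L2F iL2.
have e : c |: L = L :|: (Y :&: M).
  rewrite -[Y in RHS](setD1K cY) setIUl setUCA.
  have -> : [set c] :&: M = [set c] by apply/setIidPl; rewrite sub1set.
  by congr (_ :|: _); apply/esym/setUidPl; apply: subset_trans L2L; apply: subsetUr.
by rewrite e in cmp *; apply: mem_chain; rewrite ?subUset ?LX ?IX.
Qed.

Lemma nb_before_succ : nb (c |: before X i) = i |: nb (before X i).
Proof.
case/and5P: fY => iI cY ic _ _.
have /eqP s1 := chain_sat (before_chain i).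
have /eqP s2 := chain_sat before_succ_chain.
apply/eqP; rewrite eq_sym eqEcard s2 !cardsU1 s1 before_nb forced_notin leqnn andbT.
rewrite subUset nbS ?subsetUr // andbT sub1set; apply/nbP; split=> //.
by exists c; rewrite // setU11.
Qed.

End Forced.

(** The vertices of [I] with a forced edge in [X] are linearly ordered by the
    step at which they enter the chain. *)
Lemma before_total i c Y j c' Y' : forced X i c Y -> forced X j c' Y' -> i != j ->
  (c |: before X i \subset before X j) || (c' |: before X j \subset before X i).
Proof.
move=> fY fY' ij; have sF := before_succ_chain fY.
have [jn|jn] := boolP (j \in nb (c |: before X i)); last by rewrite before_ge.
move: jn; rewrite (nb_before_succ fY) in_setU1 eq_sym (negPf ij) /= => jn.
by rewrite (before_succ_le fY' (before_chain i) jn) orbT.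
Qed.

End InsideHall.

(** * Counting by types and defects *)

Definition upto X i c := c |: before X i.

Definition defect Y := #|Y| - #|nb Y|.

(** If [i] precedes [j] in both orders, pass from the join of the members just
    after [i] to the join [L] of those just before [j]: by [deficiency_mono] the
    deficiency does not drop.  Then add [d1] and [d2], which are distinct and
    bring in the single new neighbour [j]. *)
Lemma defect_lt X1 X2 i c1 c2 Y1 Y2 j d1 d2 Z1 Z2 :
  hall X1 -> hall X2 ->
  forced X1 i c1 Y1 -> forced X2 i c2 Y2 ->
  forced X1 j d1 Z1 -> forced X2 j d2 Z2 -> d1 != d2 ->
  upto X1 i c1 \subset before X1 j -> upto X2 i c2 \subset before X2 j ->
  defect (upto X1 i c1 :|: upto X2 i c2) < defect (upto X1 j d1 :|: upto X2 j d2).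
Proof.
rewrite /defect => h1 h2 fi1 fi2 fj1 fj2 d12 s1 s2.
have B1 := before_chain h1 j; have B2 := before_chain h2 j.
have U1 := before_succ_chain h1 fi1; have U2 := before_succ_chain h2 fi2.
have m1 := deficiency_mono (upto X2 i c2) h1 (chain_sub B1) (chain_sat B1) s1.
have m2 := deficiency_mono (before X1 j) h2 (chain_sub B2) (chain_sat B2) s2.
(* [m0] makes the first deficiency nonnegative, so that truncation is harmless *)
have m0 := deficiency_mono (upto X2 i c2) h1 (chain_sub U1) (chain_sat U1) (sub0set _).
have /eqP t2 := chain_sat U2.
move: m0 m1 m2; rewrite set0U -/(upto X2 i c2) t2 ![_ :|: before X1 j]setUC.
rewrite -/(upto X1 i c1) => m0 m1 m2.
set L := before X1 j :|: before X2 j in m1 m2 *.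
have eU : upto X1 j d1 :|: upto X2 j d2 = d1 |: (d2 |: L).
  by rewrite /upto /L -!setUA; congr (_ |: _); rewrite setUCA.
have jL : j \notin nb L by rewrite nbU in_setU negb_or; apply/andP; split; apply: before_nb.
have notL c Y X : forced X j c Y -> c \notin L.
  case/and5P => jI _ jc _ _; apply: contra jL => cL.
  by apply/nbP; split=> //; exists c.
have cU : #|upto X1 j d1 :|: upto X2 j d2| = #|L| + 2.
  have n2 := notL _ _ _ fj2; have n1 : d1 \notin d2 |: L.
    by rewrite in_setU1 negb_or d12 (notL _ _ _ fj1).
  by rewrite eU cardsU1 n1 cardsU1 n2 addnA addnC.
have nU : #|nb (upto X1 j d1 :|: upto X2 j d2)| = #|nb L| + 1.
  rewrite nbU (nb_before_succ h1 fj1) (nb_before_succ h2 fj2) setUACA setUid -nbU.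
  by rewrite cardsU1 jL addnC.
rewrite cU nU; move: m0 m1 m2; clear.
move: #|L| #|nb L| #|upto X2 i c2| #|_ :|: upto X2 i c2| #|nb (upto X1 i c1 :|: _)|.
move=> l nl x u nu. move: #|_| #|_| => a b. lia.
Qed.

(** The three members of [F] and the three pairwise defects determine [i]:
    three linear orders restricted to two elements cannot pairwise disagree. *)
Lemma card_le_types d W (F : {set {set G}}) :
  (forall X, X \in F -> hall X /\ X \subset W) ->
  (forall Y, Y \subset W -> #|Y| <= #|nb Y| + d) ->
  (forall i, i \in I -> exists c : 'I_3 -> G, injective c /\
     forall a, exists2 X : {set G}, X \in F & exists Y, forced X i (c a) Y) ->
  #|I| <= (#|F| * d.+1) ^ 3.
Proof.
move=> hF defW crit.
have ex i : exists p : ('I_3 -> G) * ('I_3 -> {set G}), i \in I -> injective p.1 /\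
    forall a, p.2 a \in F /\ exists Y, forced (p.2 a) i (p.1 a) Y.
  case: (boolP (i \in I)) => [iI|_]; last by exists (fun=> i, fun=> set0).
  have [c [injc /fin_all_exists2[X XF hX]]] := crit i iI.
  by exists (c, X) => _; split=> // a; split.
have [f fP] := fin_all_exists ex.
pose c i := (f i).1; pose X i := (f i).2.
pose u i a := upto (X i a) i (c i a).
pose h i a b := @inord d (defect (u i a :|: u i b)).
pose a0 := @Ordinal 3 0 isT; pose a1 := @Ordinal 3 1 isT; pose a2 := @Ordinal 3 2 isT.
have [a01 a02 a12] : [/\ a0 != a1, a0 != a2 & a1 != a2] by [].
pose phi i := (X i a0, X i a1, X i a2, (h i a0 a1, h i a0 a2, h i a1 a2)).
have hP i a b : i \in I -> h i a b = defect (u i a :|: u i b) :> nat.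
  move=> iI; rewrite /h /= inordK // ltnS /defect leq_subLR.
  have [_ hi] := fP i iI; apply: defW; rewrite subUset.
  have uW e : u i e \subset W.
    have [XF [Y fY]] := hi e; have [hX XW] := hF _ XF.
    exact: subset_trans (chain_sub (before_succ_chain hX fY)) XW.
  by rewrite !uW.
have lt i j a b : i \in I -> j \in I -> a != b -> X i a = X j a -> X i b = X j b ->
    u i a \subset before (X j a) j -> u i b \subset before (X j b) j ->
    h i a b <> h j a b.
  move=> iI jI ab ea eb sa sb; have [ci hi] := fP i iI; have [cj hj] := fP j jI.
  have [/hF[hXa _] [Ya fa]] := hi a; have [/hF[hXb _] [Yb fb]] := hi b.
  have [_ [Za ga]] := hj a; have [_ [Zb gb]] := hj b.
  suff : defect (u i a :|: u i b) < defect (u j a :|: u j b).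
    by rewrite -!hP // => lt_h e; rewrite e ltnn in lt_h.
  rewrite /u; move: hXa hXb fa fb sa sb; rewrite /u -/(X i a) -/(X i b) ea eb.
  move=> hXa hXb fa fb sa sb; apply: (defect_lt hXa hXb fa fb ga gb) => //.
  by apply: contra ab => /eqP/cj/eqP.
have inj : {in I &, injective phi}.
  move=> i j iI jI e; apply/eqP/negPn/negP => ij.
  have e0 : X i a0 = X j a0 := congr1 (fun p => p.1.1.1) e.
  have e1 : X i a1 = X j a1 := congr1 (fun p => p.1.1.2) e.
  have e2 : X i a2 = X j a2 := congr1 (fun p => p.1.2) e.
  have f01 : h i a0 a1 = h j a0 a1 := congr1 (fun p => p.2.1.1) e.
  have f02 : h i a0 a2 = h j a0 a2 := congr1 (fun p => p.2.1.2) e.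
  have f12 : h i a1 a2 = h j a1 a2 := congr1 (fun p => p.2.2) e.
  have tot a : X i a = X j a ->
      (u i a \subset before (X j a) j) || (u j a \subset before (X i a) i).
    move=> ea; have [_ hi] := fP i iI; have [_ hj] := fP j jI.
    have [/hF[hXa _] [Ya fa]] := hi a; have [_ [Za ga]] := hj a.
    move: hXa fa; rewrite /u -/(X i a) ea => hXa fa.
    exact: (before_total hXa fa ga).
  case/orP: (tot _ e0) => t0; case/orP: (tot _ e1) => t1; case/orP: (tot _ e2) => t2;
    first [exact: lt i j a0 a1 iI jI a01 e0 e1 t0 t1 f01
         | exact: lt i j a0 a2 iI jI a02 e0 e2 t0 t2 f02
         | exact: lt i j a1 a2 iI jI a12 e1 e2 t1 t2 f12
         | exact: lt j i a0 a1 jI iI a01 (esym e0) (esym e1) t0 t1 (esym f01)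
         | exact: lt j i a0 a2 jI iI a02 (esym e0) (esym e2) t0 t2 (esym f02)
         | exact: lt j i a1 a2 jI iI a12 (esym e1) (esym e2) t1 t2 (esym f12)].
rewrite -(card_in_imset inj).
have sub : phi @: I \subset setX (setX (setX F F) F) [set: 'I_d.+1 * 'I_d.+1 * 'I_d.+1].
  apply/subsetP => p /imsetP[i iI ->]; rewrite !inE andbT /=.
  by have [_ hi] := fP i iI; rewrite !(proj1 (hi _)).
apply: leq_trans (subset_leq_card sub) _.
by rewrite !cardsX cardsT !card_prod !card_ord expnMn !expnS !expn0 !muln1 !mulnA.
Qed.

End BipartiteDeficiency.

(** * Robust graphs *)

Section DeleteEdge.

Variables (G : sgraph) (u v : G).

Definition del_edge_adj : rel G := fun x y =>
  adj x y && ~~ ((x == u) && (y == v) || (x == v) && (y == u)).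

Lemma del_edge_sym : symmetric del_edge_adj.
Proof.
move=> x y; rewrite /del_edge_adj adj_sym; congr (_ && ~~ _).
by rewrite orbC; congr (_ || _); rewrite andbC.
Qed.

Lemma del_edge_irrefl : irreflexive del_edge_adj.
Proof. by move=> x; rewrite /del_edge_adj adj_irrefl. Qed.

Definition del_edge : sgraph := SGraph del_edge_sym del_edge_irrefl.

Lemma independent_del_edge (A : {set G}) :
  independent A -> @independent del_edge A.
Proof.
move=> /independentP iA; apply/(@independentP del_edge) => x y xA yA.
by rewrite /= /del_edge_adj negb_and iA.
Qed.

Lemma del_edge_independent (A : {set G}) :
  @independent del_edge A -> ~~ ((u \in A) && (v \in A)) -> independent A.
Proof.
move=> /(@independentP del_edge) iA uv; apply/independentP => x y xA yA.
have := iA x y xA yA; rewrite /= /del_edge_adj negb_and negbK => /orP[//|e].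
by case/negP: uv; case/orP: e => /andP[/eqP<- /eqP<-]; rewrite xA yA.
Qed.

End DeleteEdge.

(** For [m <= #|G|] this is [stable m 0 G]; phrased with witnesses and with
    [<=] so that it passes to spanning subgraphs with the same independence
    number. *)
Definition robust m (G : sgraph) := forall S : {set G}, #|S| <= m ->
  exists J : {set G}, [/\ independent J, [disjoint J & S] & alpha G <= #|J|].

Definition critical (G : sgraph) :=
  forall u v : G, adj u v -> alpha G < alpha (del_edge u v).

Section Robust.

Variable G : sgraph.
Implicit Types (A I J R X Y : {set G}).

(** Induct on [R].  Take a maximum independent set [J] missing a point of [R].
    Exchanging the neighbours of [R] in [J] for [R] cannot gain, and the part
    of [R] inside [J] is a proper subset of [R] whose neighbours avoid [J]. *)
Lemma robust_hall R : robust 1 G -> independent R -> #|R| <= #|nb [set: G] R|.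
Proof.
move=> rob; have [n] := ubnP #|R|; elim: n R => // n IH R ltRn iR.
have [->|[r rR]] := set_0Vmem R; first by rewrite cards0.
have [|J [iJ dJ cJ]] := rob [set r]; first by rewrite cards1.
have rJ : r \notin J.
  by apply/negP => rJ; move: dJ; rewrite disjoints_subset => /subsetP/(_ r rJ);
    rewrite !inE eqxx.
set N := nb _ R.
have ltRJ : #|R :&: J| < #|R|.
  apply: proper_card; apply/properP; split; first exact: subsetIl.
  by exists r => //; rewrite inE (negPf rJ) andbF.
have hRJ : #|R :&: J| <= #|N :\: J|.
  apply: leq_trans (IH _ (leq_trans ltRJ ltRn) (independentS (subsetIl _ _) iR)) _.
  apply: subset_leq_card; apply/subsetP => x /nbP[_ [c]].
  rewrite !inE => /andP[cR cJ'] xc; apply/andP; split; last first.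
    by apply/exists_inP; exists c.
  by apply/negP => xJ; move/independentP/(_ x c xJ cJ'): iJ; rewrite xc.
have iA : independent ((J :\: N) :|: R).
  apply/independentP => x y; rewrite !in_setU !in_setD.
  have nR z w : z \notin N -> w \in R -> ~~ adj z w.
    by move=> zN wR; apply: contra zN => zw; apply/nbP; split=> //; exists w.
  move=> /orP[/andP[xN xJ]|xR] /orP[/andP[yN yJ]|yR].
  - exact: (independentP _ iJ).
  - exact: nR.
  - by rewrite adj_sym nR.
  - exact: (independentP _ iR).
have RN : (J :\: N) :&: R = R :&: J.
  apply/setP => x; rewrite !in_setI in_setD; case xR: (x \in R); rewrite ?andbF ?andbT //=.
  case xJ: (x \in J); rewrite ?andbF ?andbT //; apply/negP => /nbP[_ [c cR xc]].
  by move/independentP/(_ x c xR cR): iR; rewrite xc.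
have := leq_alpha iA; have := cardsUI (J :\: N) R; rewrite RN.
have := cardsID N J; have := cardsID J N; rewrite setIC; lia.
Qed.

Section MaximumIndependent.

Variable I : {set G}.
Hypotheses (indI : independent I) (maxI : #|I| = alpha G).

(** Otherwise [Y] could be exchanged for its neighbours in [I]. *)
Lemma independent_hall Y :
  Y \subset ~: I -> independent Y -> #|Y| <= #|nb I Y|.
Proof.
move=> YI iY; have iA : independent (Y :|: (I :\: nb I Y)).
  have nY z w : z \in I :\: nb I Y -> w \in Y -> ~~ adj z w.
    rewrite in_setD => /andP[zN zI] wY; apply: contra zN => zw.
    by apply/nbP; split=> //; exists w.
  apply/independentP => x y; rewrite !in_setU => /orP[xY|xI] /orP[yY|yI].
  - exact: (independentP _ iY).
  - by rewrite adj_sym nY.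
  - exact: nY.
  - by move: xI yI; rewrite !in_setD => /andP[_ xI] /andP[_ yI]; apply: (independentP _ indI).
have := leq_alpha iA; rewrite -maxI.
have disj : Y :&: (I :\: nb I Y) = set0.
  apply/eqP; rewrite setI_eq0 disjoints_subset; apply: subset_trans YI _.
  by rewrite setCS subsetDl.
have := cardsUI Y (I :\: nb I Y); rewrite disj cards0 addn0 => ->.
have nbI : nb I Y \subset I by apply/subsetP => x /nbP[].
have := cardsID (nb I Y) I; rewrite (setIidPr nbI); lia.
Qed.

(** Apply [robust_hall] to the vertices of [I] not adjacent to [X], whose
    neighbours lie outside both [I] and [X]. *)
Lemma deficiency_bound X :
  robust 1 G -> X \subset ~: I -> #|X| + 2 * alpha G <= #|nb I X| + #|G|.
Proof.
move=> rob XI; pose R := I :\: nb I X.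
have RI : R \subset I by apply: subsetDl.
have := robust_hall rob (independentS RI indI).
have : nb setT R \subset ~: (I :|: X).
  apply/subsetP => c /nbP[_ [i]]; rewrite in_setD => /andP[iX iI] ci.
  rewrite in_setC in_setU negb_or; apply/andP; split.
    by apply/negP => cI; move/independentP/(_ c i cI iI): indI; rewrite ci.
  by apply: contra iX => cX; apply/nbP; split=> //; exists c; rewrite // adj_sym.
move/subset_leq_card.
have disj : I :&: X = set0 by apply/eqP; rewrite setIC setI_eq0 disjoints_subset.
have nbI : nb I X \subset I by apply/subsetP => x /nbP[].
have := cardsID (nb I X) I; rewrite (setIidPr nbI) -/R maxI.
have := cardsC (I :|: X); have := cardsUI I X; rewrite disj cards0 addn0.
rewrite maxI; lia.
Qed.

(** Deleting [ic] creates an independent set [A] of size [alpha G + 1], in which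
    [ic] is the only edge of [G].  Its part [Y] outside [I] has a single
    neighbour in [A :&: I], which forces equality in Hall's condition for
    both [Y] and [Y :\ c]. *)
Lemma critical_forced i c : critical G -> i \in I -> adj i c ->
  exists Y, [/\ independent Y, Y \subset ~: I & forall X, Y \subset X -> forced I X i c Y].
Proof.
move=> crit iI ic.
have [A iA cA] : exists2 A : {set G}, @independent (del_edge i c) A & alpha G < #|A|.
  by have [A iA cA] := alpha_witness (del_edge i c); exists A; rewrite // cA crit.
have /andP[iA' cA'] : (i \in A) && (c \in A).
  apply/negPn/negP => n; have := leq_alpha (del_edge_independent iA n).
  by rewrite leqNgt cA.
have only x y : x \in A -> y \in A -> adj x y -> (x == i) && (y == c) || (x == c) && (y == i).
  move=> xA yA xy; have := elimT (@independentP (del_edge i c) A) iA x y xA yA.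
  by rewrite /= /del_edge_adj xy negbK.
have cI : c \notin I by apply/negP => cI; move/independentP/(_ i c iI cI): indI; rewrite ic.
have i_c : i != c by apply: contraNneq cI => <-.
pose Y := A :\: I; pose R := A :&: I.
have YI : Y \subset ~: I by apply/subsetP => x; rewrite !inE => /andP[].
have iY : independent Y.
  apply/independentP => x y; rewrite !in_setD => /andP[xI xA] /andP[yI yA].
  apply/negP => /(only _ _ xA yA) /orP[/andP[/eqP e _]|/andP[_ /eqP e]].
    by rewrite e iI in xI.
  by rewrite e iI in yI.
have cY : c \in Y by rewrite in_setD cI.
have nY : nb I Y \subset i |: (I :\: R).
  apply/subsetP => x /nbP[xI [y]]; rewrite in_setD => /andP[yI yA] xy.
  rewrite in_setU1 in_setD in_setI xI !andbT.
  have [xA|] := boolP (x \in A); last by rewrite orbT.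
  case/orP: (only _ _ xA yA xy) => /andP[/eqP-> /eqP]; first by rewrite eqxx.
  by move=> e; rewrite e iI in yI.
have iYc : i \notin nb I (Y :\ c).
  apply/negP => /nbP[_ [y]]; rewrite in_setD1 in_setD => /and3P[yc yI yA] iy.
  case/orP: (only _ _ iA' yA iy) => /andP[/eqP e /eqP e']; first by rewrite e' eqxx in yc.
  by rewrite e eqxx in i_c.
have nYc : nb I (Y :\ c) \subset I :\: R.
  apply/subsetP => x xN; have := subsetP nY x (subsetP (nbS _ (subsetDl _ _)) x xN).
  by rewrite in_setU1 => /orP[/eqP e|//]; rewrite -e xN in iYc.
have iR : i \in R by rewrite in_setI iA'.
have hY := independent_hall YI iY.
have hYc : #|Y :\ c| <= #|nb I (Y :\ c)|.
  apply: independent_hall; first exact: subset_trans (subsetDl _ _) YI.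
  exact: independentS (subsetDl _ _) iY.
have := cardsID I A; rewrite -/R -/Y => eA.
have := subset_leq_card nY; have := subset_leq_card nYc.
have := cardsID R I; have -> : I :&: R = R by apply/setIidPr/subsetIr.
rewrite maxI => eI.
rewrite cardsU1 in_setD iR /= => l1 l2; have eY := cardsD1 c Y; rewrite cY in eY.
have [sY sYc] : #|nb I Y| = #|Y| /\ #|nb I (Y :\ c)| = #|Y :\ c|.
  move: eY cA eA eI l1 l2 hY hYc; clear.
  move: #|Y :\ c| #|nb I (Y :\ c)| => y' n'. lia.
exists Y; split=> // X YX; apply/and5P; split=> //; apply/and3P; split=> //.
  exact/eqP.
exact/eqP.
Qed.

End MaximumIndependent.

(** Any independent set avoiding [x] and its neighbours can be extended by [x],
    so these cannot be among the at most three deleted vertices. *)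
Lemma robust_degree (x : G) : robust 3 G -> 2 < #|[set c | adj x c]|.
Proof.
move=> rob; set N := [set c | adj x c]; rewrite ltnNge; apply/negP => cN.
have [|J [iJ dJ cJ]] := rob (x |: N); first by rewrite cardsU1; case: (x \in N) => /=; lia.
have dis y : y \in J -> y \notin x |: N.
  by move=> yJ; move: dJ; rewrite disjoints_subset => /subsetP/(_ y yJ); rewrite in_setC.
have xJ : x \notin J by apply/negP => /dis; rewrite setU11.
have iA : independent (x |: J).
  apply/independentP => y z; rewrite !in_setU1 => /orP[/eqP->|yJ] /orP[/eqP->|zJ].
  - by rewrite adj_irrefl.
  - by have := dis z zJ; rewrite in_setU1 inE negb_or => /andP[].
  - by have := dis y yJ; rewrite adj_sym in_setU1 inE negb_or => /andP[].
  - exact: (independentP _ iJ).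
by have := leq_alpha iA; rewrite cardsU1 xJ; lia.
Qed.

Lemma robustW m k : m <= k -> robust k G -> robust m G.
Proof. by move=> mk rob S Sm; apply: rob; apply: leq_trans mk. Qed.

Lemma critical_robust_bound d : critical G -> robust 3 G -> #|G| = 2 * alpha G + d ->
  alpha G <= (2 ^ d * d.+1) ^ 3.
Proof.
move=> crit rob cG; have [I iI cI] := alpha_witness G; rewrite -cI.
have rob1 := robustW (isT : 1 <= 3) rob.
have defI X : X \subset ~: I -> #|X| <= #|nb I X| + d.
  by move=> /(deficiency_bound iI cI rob1); rewrite cG; lia.
have [F [cF hF covF]] := hall_cover (independent_hall iI cI) defI.
apply: (@leq_trans ((#|F| * d.+1) ^ 3)); last by rewrite leq_exp2r // leq_mul2r cF orbT.
apply: (card_le_types hF defI) => i iI'.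
have := robust_degree i rob; set N := [set c | adj i c] => cN.
(* three distinct neighbours of [i], all outside [I] *)
exists (fun a => enum_val (widen_ord cN a)); split=> [a b /enum_val_inj/(congr1 val)|a].
  by move=> e; apply: val_inj.
set c := enum_val _; have : c \in N by apply: enum_valP.
rewrite inE => ic; have [Y [iY YI fY]] := critical_forced iI cI crit iI' ic.
by have [X XF YX] := covF Y YI iY; exists X => //; exists Y; apply: fY.
Qed.

End Robust.

(** Non-critical edges are deleted one at a time; this changes neither the
    vertex set, nor [alpha], nor robustness. *)
Lemma robust_bound (G : sgraph) d : robust 3 G -> #|G| = 2 * alpha G + d ->
  alpha G <= (2 ^ d * d.+1) ^ 3.
Proof.
have [n] := ubnP #|[set p : G * G | adj p.1 p.2]|.
elim: n G => // n IH G edges rob cG.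
have [/forallP crit|] := boolP
  [forall u : G, forall v : G, adj u v ==> (alpha G < alpha (del_edge u v))].
  by apply: critical_robust_bound => // u v uv; move/forallP/(_ v)/implyP: (crit u); apply.
move=> /forallPn[u /forallPn[v]]; rewrite negb_imply -leqNgt => /andP[uv le].
have e : alpha (del_edge u v) = alpha G.
  apply/eqP; rewrite eqn_leq le /=; have [A iA <-] := alpha_witness G.
  by apply: leq_alpha; apply: independent_del_edge.
rewrite -e; apply: IH; last by rewrite e.
  apply: (@leq_trans #|[set p : G * G | adj p.1 p.2]|); last by rewrite -ltnS.
  apply: proper_card; apply/properP; split.
    by apply/subsetP => p; rewrite !inE => /andP[].
  by exists (u, v); rewrite !inE //= /del_edge_adj !eqxx andbF.
move=> S S3; have [J [iJ dJ cJ]] := rob S S3; exists J; split=> //.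
  exact: independent_del_edge.
by rewrite e.
Qed.

Lemma robust_card (G : sgraph) d : robust 3 G -> #|G| <= 2 * alpha G + d ->
  #|G| <= 2 * (2 ^ d * d.+1) ^ 3 + d.
Proof.
move=> rob cG; have [I iI cI] := alpha_witness G.
have := deficiency_bound iI cI (robustW (isT : 1 <= 3) rob) (sub0set _).
have -> : nb I set0 = set0.
  by apply/setP => i; rewrite in_set0; apply/nbP => -[_ [c]]; rewrite in_set0.
rewrite cards0 => geG; pose e := #|G| - 2 * alpha G.
have eG : #|G| = 2 * alpha G + e by rewrite /e; lia.
have ed : e <= d by rewrite /e; lia.
have := robust_bound rob eG.
have : (2 ^ e * e.+1) ^ 3 <= (2 ^ d * d.+1) ^ 3.
  by rewrite leq_exp2r // leq_mul // leq_exp2l.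
rewrite eG; move: (_ ^ 3) (_ ^ 3) => x y; lia.
Qed.

(** * Deleting triples from a tight graph *)

Section Induced.

Variable G : sgraph.
Implicit Types A D S : {set G}.

Lemma independent_preimset A D :
  independent A -> @independent (induced D) [set x : induced D | val x \in A].
Proof.
move=> /independentP iA; apply/(@independentP (induced D)) => x y.
by rewrite !inE; apply: iA.
Qed.

Lemma card_preimset_val A D :
  A \subset D -> #|[set x : induced D | val x \in A]| = #|A|.
Proof.
move=> /subsetP AD; rewrite -(card_imset _ val_inj); apply: eq_card => x.
apply/imsetP/idP => [[y]|xA]; first by rewrite inE => yA ->.
by exists (Sub x (AD x xA)); rewrite ?inE SubK.
Qed.

Lemma leq_alpha_induced A D :
  independent A -> A \subset D -> #|A| <= alpha (induced D).
Proof.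
by move=> iA AD; rewrite -(card_preimset_val AD) leq_alpha ?independent_preimset.
Qed.

Lemma alpha_induced_witness D :
  exists A : {set G}, [/\ independent A, A \subset D & #|A| = alpha (induced D)].
Proof.
have [B iB cB] := alpha_witness (induced D).
exists [set val x | x in B]; split; last by rewrite card_imset //; exact: val_inj.
  apply/independentP => x y /imsetP[x' xB ->] /imsetP[y' yB ->].
  exact: (elimT (@independentP (induced D) B) iB).
by apply/subsetP => x /imsetP[y _ ->]; apply: valP.
Qed.

Lemma alpha_inducedS D D' :
  D \subset D' -> alpha (induced D) <= alpha (induced D').
Proof.
move=> DD'; have [A [iA AD <-]] := alpha_induced_witness D.
by apply: leq_alpha_induced => //; apply: subset_trans DD'.
Qed.

Lemma card_induced D : #|induced D| = #|D|.
Proof.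
rewrite -[RHS](card_preimset_val (subxx D)) -cardsT; apply: eq_card => x.
by rewrite !inE (valP x).
Qed.

Lemma robust_or_drop m D : robust m (induced D) \/
  exists2 S : {set G}, #|S| <= m & alpha (induced (D :\: S)) < alpha (induced D).
Proof.
have [/forallP rob|/forallPn[S]] := boolP
  [forall S : {set induced D}, (#|S| <= m) ==> [exists J : {set induced D},
    [&& independent J, [disjoint J & S] & alpha (induced D) <= #|J|]]].
  left=> S Sm; have /existsP[J /and3P[iJ dJ cJ]] := implyP (rob S) Sm.
  by exists J.
rewrite negb_imply => /andP[Sm /existsPn noJ]; right.
exists [set val x | x in S]; first by rewrite card_imset //; apply: val_inj.
have [A [iA AD <-]] := alpha_induced_witness (D :\: [set val x | x in S]).
have := noJ [set x : induced D | val x \in A].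
rewrite independent_preimset //= card_preimset_val; last first.
  by apply: subset_trans AD _; apply: subsetDl.
rewrite negb_and -ltnNge => /orP[/negP[]|//].
rewrite disjoints_subset; apply/subsetP => x; rewrite inE => /(subsetP AD).
by rewrite in_setD => /andP[xS _]; rewrite in_setC; apply: contra xS => xS; apply: imset_f.
Qed.

(** While at most [3 * l] vertices have been removed, [alpha] has lost at most
    [l], so the deficiency of what remains is at most [d = e + 2 * l]; if [D] is
    larger than the bound, [robust_card] supplies three more vertices whose
    removal lowers [alpha].  After [l + 1] rounds [alpha] has lost [l + 1]. *)
Lemma descent l e D :
  (forall S : {set G}, #|S| <= 3 * l + 3 -> alpha (induced D) <= alpha (induced (D :\: S)) + l) ->
  #|D| <= 2 * alpha (induced D) + e ->
  #|D| <= 3 * l + (2 * (2 ^ (e + 2 * l) * (e + 2 * l).+1) ^ 3 + (e + 2 * l)).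
Proof.
set d := e + 2 * l => stab cD; rewrite leqNgt; apply/negP => big.
have drop m : m <= l.+1 ->
    exists2 S : {set G}, #|S| <= 3 * m & alpha (induced (D :\: S)) + m <= alpha (induced D).
  elim: m => [_|m IH ml]; first by exists set0; rewrite ?cards0 // setD0 addn0.
  have [S cS aS] := IH (ltnW ml).
  have [rob|[S' cS' aS']] := robust_or_drop 3 (D :\: S); last first.
    exists (S :|: S'); last by rewrite -setDDl; lia.
    by have := cardsUI S S'; lia.
  have DS : #|D| <= #|D :\: S| + #|S|.
    have := cardsID S D; have := subset_leq_card (subsetIr D S); lia.
  have sS : alpha (induced D) <= alpha (induced (D :\: S)) + l by apply: stab; lia.
  have cDS : #|D :\: S| <= #|D| by apply: subset_leq_card; apply: subsetDl.
  have := robust_card (d := d) rob; rewrite card_induced => H.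
  have {H} := H ltac:(rewrite /d; lia).
  move: big; move: (2 * _) => N; lia.
have [S cS aS] := drop l.+1 (leqnn _).
have := stab S; lia.
Qed.

End Induced.

Lemma stable_le k l (G : sgraph) (S : {set G}) : stable k l G -> k <= #|G| ->
  #|S| <= k -> alpha G <= alpha (induced (~: S)) + l.
Proof.
move=> st kG Sk; have [|S' SS' cS'] := @card_extend G S k; first by rewrite Sk.
have := st S' cS'; rewrite /del_vertices.
have : alpha (induced (~: S')) <= alpha (induced (~: S)).
  by apply: alpha_inducedS; rewrite setCS.
lia.
Qed.

(** With [3 * l + 4 <= 2 ^ (3 * l + 4)] the left-hand side is at most
    [2 ^ (18 * l + 23)]. *)
Lemma numeric_bound l :
  3 * l + (2 * (2 ^ (l + 3 + 2 * l) * (l + 3 + 2 * l).+1) ^ 3 + (l + 3 + 2 * l))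
    <= 2 ^ (3 * (l + 4) ^ 2).
Proof.
have le1 : (2 ^ (l + 3 + 2 * l) * (l + 3 + 2 * l).+1) ^ 3 <= 2 ^ (18 * l + 21).
  have -> : 18 * l + 21 = (6 * l + 7) * 3 by lia.
  rewrite expnM leq_exp2r //; have -> : 6 * l + 7 = l + 3 + 2 * l + (3 * l + 4) by lia.
  rewrite (expnD _ (l + 3 + 2 * l) (3 * l + 4)) leq_mul2l; apply/orP; right.
  by apply: leq_trans (ltnW (@ltn_expl 2 _ isT)) _; rewrite leq_exp2l //; lia.
have le2 : 6 * l + 3 < 2 ^ (18 * l + 22).
  by apply: leq_trans (@ltn_expl 2 _ isT) _; rewrite leq_exp2l //; lia.
have le3 : 2 ^ (18 * l + 23) <= 2 ^ (3 * (l + 4) ^ 2) by rewrite leq_exp2l //; nia.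
apply: leq_trans le3; move: le1 le2; move: (_ ^ 3) => x.
have -> : 18 * l + 23 = (18 * l + 21).+2 by lia.
have -> : 18 * l + 22 = (18 * l + 21).+1 by lia.
rewrite !expnS; move: (2 ^ _) => y; lia.
Qed.

Lemma tight_card k l (G : sgraph) : 3 * l + 3 <= k -> tight k l G ->
  #|G| <= (k - 3 * l - 3) + 2 ^ (3 * (l + 4) ^ 2).
Proof.
move=> kl [st tG].
have [kG|Gk] := leqP k #|G|; last first.
  have : 3 * l + 3 < 2 ^ (3 * (l + 4) ^ 2).
    by apply: leq_trans (@ltn_expl 2 _ isT) _; rewrite leq_exp2l //; nia.
  move: (2 ^ _) => N; lia.
have [lo hi] : #|G| <= k + 2 * (alpha G - l) /\ 2 * alpha G <= #|G| + 1 + 2 * l - k.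
  by split; lia.
have la : l <= alpha G by lia.
have [I iI cI] := alpha_witness G.
(* [D] keeps a maximum independent set and omits [k - 3 * l - 3] vertices *)
have [|D ID cD] := @card_extend G I (#|G| - (k - 3 * l - 3)); first by lia.
have aD : alpha (induced D) = alpha G.
  apply/eqP; rewrite eqn_leq -{2}cI leq_alpha_induced // andbT.
  by have [A [iA _ <-]] := alpha_induced_witness D; apply: leq_alpha.
have stab (S : {set G}) : #|S| <= 3 * l + 3 ->
    alpha (induced D) <= alpha (induced (D :\: S)) + l.
  move=> cS; have -> : D :\: S = ~: (~: D :|: S) by rewrite setCU setCK setDE.
  rewrite aD; apply: (stable_le st kG).
  have := cardsUI (~: D) S; have := cardsC D; lia.
have defD : #|D| <= 2 * alpha (induced D) + (l + 3) by rewrite aD cD; lia.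
have := leq_trans (descent stab defD) (numeric_bound l).
rewrite cD; move: (2 ^ _) => M; lia.
Qed.

Theorem corollary1p7 :
  (forall k l : nat, 3 * l + 3 <= k ->
     forall G : sgraph, tight k l G ->
       #|G| <= (k - 3 * l - 3) + 2 ^ (3 * (l + 4) ^ 2)) /\
  (forall k : nat, 6 <= k ->
     forall G : sgraph, tight k 1 G -> #|G| <= (k - 6) + 2 ^ 75).
Proof.
split=> [k l kl G|k k6 G tG]; first exact: tight_card.
have := @tight_card k 1 G k6 tG.
by rewrite -subnDA (_ : 3 * (1 + 4) ^ 2 = 75).
Qed.
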